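(* Let $k\ge 1$ be an integer. There is $n_0=n_0(k)$ such that for every $n\ge n_0$ the following holds. Let $H$ be a $2k$-uniform hypergraph on $n$ vertices that contains no copy of ${\cal C}^{(2k)}_3$. Then $e(H)\le b_{2k}(n)$, and equality holds only if $H$ is isomorphic to ${\cal B}^{(2k)}(n,t)$ for some $t$ attaining the maximum in the definition of $b_{2k}(n)$.
   Context: For integers $k\ge1$, $r\ge 2$, ${\cal C}^{(2k)}_r$ denotes the $2k$-uniform hypergraph obtained by taking pairwise disjoint sets $P_1,\dots,P_r$ each of size $k$ and taking as edges all sets $P_i\cup P_j$ with $i\neq j$. For $n$ and $t$ with $n/2+t$ a nonnegative integer and $|t|\le n/2$, ${\cal B}^{(2k)}(n,t)$ is the $2k$-uniform hypergraph whose vertex set of size $n$ is partitioned into $V_1,V_2$ with $|V_1|=n/2+t$, $|V_2|=n/2-t$, and whose edges are all $2k$-subsets intersecting each of $V_1$ and $V_2$ in an odd number of elements. $b_{2k}(n,t)$ denotes its number of edges and $b_{2k}(n)=\max_t b_{2k}(n,t)$ over all admissible $t$. *)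

(* Defs.v *)
From mathcomp Require Import all_boot perm.
Set Implicit Arguments. Unset Strict Implicit. Unset Printing Implicit Defensive.

Definition uniform (n r : nat) (H : {set {set 'I_n}}) : Prop :=
  forall e, e \in H -> #|e| = r.

Definition has_C3 (n k : nat) (H : {set {set 'I_n}}) : Prop :=
  exists P1 P2 P3 : {set 'I_n},
    [/\ #|P1| = k, #|P2| = k & #|P3| = k] /\
    [/\ [disjoint P1 & P2], [disjoint P1 & P3] & [disjoint P2 & P3]] /\
    [/\ P1 :|: P2 \in H, P1 :|: P3 \in H & P2 :|: P3 \in H].

(* B^{(2k)}(n,t) with a = |V1| = n/2 + t, V1 = {0,..,a-1}, V2 its complement:
   all 2k-sets meeting V1 and V2 in an odd number of vertices. *)
Definition V1 (n a : nat) : {set 'I_n} := [set i : 'I_n | i < a].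

Definition Bhyp (n k a : nat) : {set {set 'I_n}} :=
  [set e : {set 'I_n} | (#|e| == 2 * k) && odd #|e :&: V1 n a|
                        && odd #|e :&: ~: V1 n a|].

(* b_{2k}(n) = max over admissible t, i.e. over a = n/2 + t in {0,..,n}. *)
Definition bmax (n k : nat) : nat := \max_(a < n.+1) #|Bhyp n k a|.

Definition hiso (n : nat) (H G : {set {set 'I_n}}) : Prop :=
  exists s : {perm 'I_n}, H = [set [set s x | x in e] | e : {set 'I_n} in G].

(* Main.v *)
Require Import Defs.
From mathcomp Require Import all_boot perm.
From mathcomp Require Import zify.
Set Implicit Arguments. Unset Strict Implicit. Unset Printing Implicit Defensive.

(* Join two disjoint k-sets when their union is an edge of H: this graph is
   triangle-free, and H has about half of all 2k-sets, so by stability for Mantel's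
   theorem the k-sets are 2-coloured by some f with h(P u Q) = f(P) + f(Q) mod 2 for
   all but a fraction O(1/n) of the pairs, h being the indicator of H.  Whenever this
   holds for all pairs inside a (4k-1)-set S u E with |S| = 2k-1 and |E| = 2k,
   swapping elements gives h(E) = sum of h(S + v) over v in E; averaging over S, the
   link U of a suitable S makes H agree with the odd family of U up to O(n^(2k-1))
   edges.
   Deleting a vertex of degree below C(n-1,2k-1)/2 increases the excess over b(n),
   because adding a vertex to one side or the other of an optimal partition gains
   at least C(n-1,2k-1)/2 edges; so one may assume that no such vertex exists.  Take U
   with the largest number of good (odd) edges.  Then every vertex lies on few bad
   edges, hence on few missing odd sets.  Call a k-set heavy if at least 1/8 of all
   k-sets form a missing set with it.  A bad edge split into two k-sets has a heavy
   half, so it contains two heavy sets that meet in exactly one vertex; as few heavy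
   sets pass through a vertex, there are far fewer bad edges than missing sets, unless
   there are none. *)

(* In the lemmas below the part size of the forbidden configuration, called k in the
   theorem, is [k.+1], often abbreviated to [q]. *)

(** * Counting in uniform families *)

Definition ksets (T : finType) (m : nat) : {set {set T}} :=
  [set A : {set T} | #|A| == m].

Definition adj (T : finType) (F : {set {set T}}) (A B : {set T}) : bool :=
  [disjoint A & B] && (A :|: B \in F).

Definition nbr (T : finType) (F : {set {set T}}) (q : nat) (A : {set T}) :
    {set {set T}} :=
  [set B in ksets T q | adj F A B].

Definition star (T : finType) (F : {set {set T}}) (v : T) : {set {set T}} :=
  [set E in F | v \in E].

Definition parity_family (T : finType) (m : nat) (U : {set T}) : {set {set T}} :=
  [set E in ksets T m | odd #|E :&: U|].

Section Counting.
Variable T : finType.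
Implicit Types (A B E S U : {set T}) (F G : {set {set T}}).

Lemma card_ksets m : #|ksets T m| = 'C(#|T|, m).
Proof. exact: card_draws. Qed.

Lemma adj_sym F A B : adj F A B = adj F B A.
Proof. by rewrite /adj disjoint_sym setUC. Qed.

Lemma disjoint_card A B : [disjoint A & B] -> #|A :|: B| = #|A| + #|B|.
Proof. by rewrite -setI_eq0 => /eqP dAB; rewrite cardsU dAB cards0 subn0. Qed.

Lemma disjoint_setU A B E : [disjoint A :|: B & E] = [disjoint A & E] && [disjoint B & E].
Proof. by rewrite !disjoints_subset subUset. Qed.

Lemma disjoint_setU1 v A B : [disjoint v |: A & B] = (v \notin B) && [disjoint A & B].
Proof. by rewrite disjoint_setU disjoints1. Qed.

Lemma sum_indicator (I : finType) (P Q : pred I) :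
  \sum_(i | P i) (Q i : nat) = #|[set i | P i && Q i]|.
Proof.
rewrite -sum1dep_card big_mkcondr /=; apply: eq_bigr => i _.
by case: (Q i).
Qed.

Lemma double_count (I J : finType) (A : {set I}) (B : {set J}) (r : I -> J -> bool) :
  \sum_(i in A) #|[set j in B | r i j]| = \sum_(j in B) #|[set i in A | r i j]|.
Proof.
under eq_bigr => i _ do rewrite -sum_indicator.
rewrite exchange_big /=; apply: eq_bigr => j _.
by rewrite sum_indicator.
Qed.

Lemma card_nbr F p q A : {in F, forall E, #|E| = p + q} -> #|A| = p ->
  #|nbr F q A| = #|[set E in F | A \subset E]|.
Proof.
move=> Fr cA.
have inj : {in [set E in F | A \subset E] &, injective (fun E => E :\: A)}.
  move=> E E'; rewrite !inE => /andP[_ sE] /andP[_ sE'] eqD.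
  by rewrite -(setID E A) -(setID E' A) eqD (setIidPr sE) (setIidPr sE').
rewrite -(card_in_imset inj); apply: eq_card => B; rewrite !inE.
apply/andP/imsetP => [[/eqP cB /andP[dAB inF]]|[E]].
  exists (A :|: B); first by rewrite inE inF subsetUl.
  rewrite setDUl setDv set0U; apply/esym/setDidPl.
  by rewrite disjoint_sym.
rewrite inE => /andP[EF sE] ->; rewrite cardsD (setIidPr sE) cA Fr // addKn.
rewrite eqxx /adj disjoint_sym disjoints_subset setDE subsetIr /=.
by rewrite setUIr setUCr setIT (setUidPr sE) EF.
Qed.

Lemma sum_card_nbr p q F : {in F, forall E, #|E| = p + q} ->
  \sum_(A in ksets T p) #|nbr F q A| = #|F| * 'C(p + q, p).
Proof.
move=> Fr.
rewrite (eq_bigr (fun A => #|[set E in F | A \subset E]|)); last first.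
  by move=> A; rewrite inE => /eqP; apply: card_nbr.
rewrite double_count -sum_nat_const; apply: eq_bigr => E EF.
rewrite -(Fr E EF) -cards_draws; apply: eq_card => A; rewrite !inE.
by rewrite andbC.
Qed.

Lemma sum_star r F : {in F, forall E, #|E| = r} ->
  \sum_v #|star F v| = #|F| * r.
Proof.
move=> Fr; have -> : \sum_v #|star F v| = \sum_(v in [set: T]) #|[set E in F | v \in E]|.
  by apply: eq_bigl => v; rewrite inE.
rewrite double_count -sum_nat_const; apply: eq_bigr => E /Fr <-.
by apply: eq_card => v; rewrite !inE.
Qed.

Definition link F (v : T) : {set {set T}} := [set X : {set T} | (v \notin X) && (v |: X \in F)].

Lemma card_link F v : #|link F v| = #|star F v|.
Proof.
have inj : {in link F v &, injective (fun X => v |: X)}.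
  move=> X Y; rewrite !inE => /andP[vX _] /andP[vY _] eqXY.
  by rewrite -(setU1K vX) eqXY setU1K.
rewrite -(card_in_imset inj); apply: eq_card => E; rewrite inE.
apply/imsetP/andP => [[X]|[EF vE]]; first by rewrite inE => /andP[_ ?] ->; rewrite setU11.
by exists (E :\ v); rewrite ?inE ?eqxx setD1K.
Qed.

Lemma adj_link F v A B : v \notin A -> adj F (v |: A) B = adj (link F v) A B.
Proof.
move=> vA; rewrite /adj disjoint_setU1 !inE negb_or vA /= setUA.
by rewrite -andbA andbCA.
Qed.

Lemma sum_star_nbr F p q v : {in F, forall E, #|E| = (p + q).+1} ->
  \sum_(A in ksets T p | v \notin A) #|nbr F q (v |: A)|
  = #|star F v| * 'C(p + q, p).
Proof.
move=> Fr; rewrite -card_link -sum_card_nbr => [|X]; last first.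
  by rewrite inE => /andP[vX /Fr]; rewrite cardsU1 vX => -[].
rewrite big_mkcondr /=; apply: eq_bigr => A _; case: ifP => [vA|/negbFE vA].
  by apply: eq_card => B; rewrite !inE adj_link.
apply/esym/eqP; rewrite cards_eq0 -subset0; apply/subsetP => B.
by rewrite !inE /adj !inE vA !andbF.
Qed.

Lemma card_star_ksets m v : #|star (ksets T m.+1) v| = 'C(#|T|.-1, m).
Proof.
rewrite -card_link; have -> : #|T|.-1 = #|[set~ v]| by rewrite cardsC1.
rewrite -cards_draws; apply: eq_card => X; rewrite !inE subsets_disjoint setCK.
rewrite disjoint_sym disjoints1; case vX: (v \in X) => //=.
by rewrite cardsU1 vX eqSS.
Qed.

Lemma card_supersets m E : #|[set W in ksets T m | E \subset W]| <= 'C(#|T|, m - #|E|).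
Proof.
have inj : {in [set W in ksets T m | E \subset W] &, injective (fun W => W :\: E)}.
  move=> W X; rewrite !inE => /andP[_ sW] /andP[_ sX] eqD.
  by rewrite -(setID W E) -(setID X E) eqD (setIidPr sW) (setIidPr sX).
rewrite -(card_in_imset inj) -card_ksets subset_leq_card //.
apply/subsetP => _ /imsetP[W + ->]; rewrite !inE => /andP[/eqP <- sW].
by rewrite cardsD (setIidPr sW).
Qed.

Lemma card_meeting m E :
  #|[set A in ksets T m.+1 | ~~ [disjoint A & E]]| <= #|E| * 'C(#|T|.-1, m).
Proof.
apply: (@leq_trans (\sum_(v in E) #|star (ksets T m.+1) v|)); last first.
  by rewrite (eq_bigr (fun _ => 'C(#|T|.-1, m))) ?sum_nat_const // => v _; rewrite card_star_ksets.
rewrite double_count -sum1_card big_mkcond [leqRHS]big_mkcond /=.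
apply: leq_sum => A _; rewrite inE; case: (A \in _) => //=.
case: ifP => // /pred0Pn[v /andP[/= vA vE]].
by rewrite card_gt0; apply/set0Pn; exists v; rewrite inE vE.
Qed.

Lemma parity_setU A B U : [disjoint A & B] ->
  odd #|(A :|: B) :&: U| = odd #|A :&: U| (+) odd #|B :&: U|.
Proof.
move=> dAB; rewrite setIUl disjoint_card ?oddD //.
by apply: disjointWl (subsetIl _ _) (disjointWr (subsetIl _ _) dAB).
Qed.

End Counting.

(** * Approximate structure *)

(* As in Füredi's proof of stability for Mantel's theorem, one side of the
   bipartition is the neighbourhood of a vertex of maximum degree. *)
Lemma mantel_stability (X : finType) (S : {set X}) (a : rel X) :
  symmetric a ->
  {in S & &, forall x y z, a x y -> a x z -> a y z -> False} ->
  exists Y : {set X},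
    2 * \sum_(x in S) #|[set y in S | a x y != ((x \in Y) != (y \in Y))]|
    + 6 * \sum_(x in S) #|[set y in S | a x y]| <= 3 * #|S| ^ 2.
Proof.
move=> a_sym a_tri; have [->|[x1 x1S]] := set_0Vmem S.
  by exists set0; rewrite !big_set0.
pose d x := #|[set y in S | a x y]|.
have [x0 x0S d_max] : exists2 x0, x0 \in S & forall x, x \in S -> d x <= d x0.
  by case: (arg_maxnP d x1S) => x0; exists x0.
pose Y := [set y in S | a x0 y]; pose Z := S :\: Y.
have sYS : Y \subset S by apply/subsetP => y; rewrite inE => /andP[].
pose dY x := #|[set y in Y | a x y]|; pose dZ x := #|[set y in Z | a x y]|.
pose mis x := #|[set y in S | a x y != ((x \in Y) != (y \in Y))]|.
have split_card (p : pred X) : #|[set y in S | p y]| = #|[set y in Y | p y]| + #|[set y in Z | p y]|.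
  rewrite -(cardsID Y); congr (_ + _); apply: eq_card => y; rewrite !inE.
    by case: (y \in S); case: (a x0 y); rewrite ?andbT ?andbF.
  by case: (y \in S); case: (a x0 y); rewrite ?andbT ?andbF.
have cardZ : #|Y| + #|Z| = #|S| by rewrite cardsD (setIidPr sYS) subnKC // subset_leq_card.
have dE x : d x = dY x + dZ x by exact: split_card.
have indep x y : x \in Y -> y \in Y -> a x y = false.
  rewrite !inE => /andP[xS a0x] /andP[yS a0y]; apply/negP => axy.
  exact: (a_tri x0 x y).
have dY0 x : x \in Y -> dY x = 0.
  move=> xY; apply/eqP; rewrite cards_eq0; apply/eqP/setP => y; rewrite in_set in_set0.
  by case yY: (y \in Y) => //=; exact: indep.
have cardC (B : {set X}) (p : pred X) : #|[set y in B | ~~ p y]| + #|[set y in B | p y]| = #|B|.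
  rewrite addnC -[RHS](cardsID [set y | p y]); congr (_ + _); apply: eq_card => y; rewrite !inE //.
  by rewrite andbC.
have misY x : x \in Y -> mis x + dZ x = #|Z|.
  move=> xY; rewrite /mis split_card -(cardC Z (a x)) -[RHS]add0n addnA; congr (_ + _ + _).
    apply/eqP; rewrite cards_eq0; apply/eqP/setP => y; rewrite in_set in_set0 xY.
    by case yY: (y \in Y) => //=; rewrite indep.
  apply: eq_card => y; rewrite in_set in_set xY; case yZ: (y \in Z) => //=.
  by move: yZ; rewrite in_setD => /andP[/negbTE-> _]; case: (a x y).
have misZ x : x \in Z -> mis x + dY x = #|Y| + dZ x.
  rewrite in_setD => /andP[/negbTE xY _].
  rewrite /mis split_card -(cardC Y (a x)) addnAC; congr (_ + _ + _).
    apply: eq_card => y; rewrite in_set in_set xY; case yY: (y \in Y) => //=.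
    by case: (a x y).
  apply: eq_card => y; rewrite in_set in_set xY; case yZ: (y \in Z) => //=.
  by move: yZ; rewrite in_setD => /andP[/negbTE-> _]; case: (a x y).
have sumS (f : X -> nat) : \sum_(x in S) f x = \sum_(x in Y) f x + \sum_(x in Z) f x.
  rewrite (big_setID Y) /=; congr (_ + _); apply: eq_bigl => x.
  by rewrite (setIidPr sYS).
exists Y; rewrite -/(\sum_(x in S) mis x) -/(\sum_(x in S) d x).
have e1 : \sum_(x in Y) mis x + \sum_(x in Y) dZ x = #|Y| * #|Z|.
  by rewrite -big_split /= -sum_nat_const; apply: eq_bigr => x /misY.
have e2 : \sum_(x in Z) mis x + \sum_(x in Z) dY x = #|Z| * #|Y| + \sum_(x in Z) dZ x.
  by rewrite -big_split /= -sum_nat_const -big_split /=; apply: eq_bigr => x /misZ.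
have e3 : \sum_(x in Y) dZ x = \sum_(x in Z) dY x.
  rewrite /dZ double_count; apply: eq_bigr => z _.
  by apply: eq_card => y; rewrite !inE (a_sym y z).
have e4 : \sum_(x in Z) d x <= #|Z| * #|Y|.
  rewrite -sum_nat_const; apply: leq_sum => x; rewrite in_setD => /andP[_ xS].
  exact: d_max.
have e5 : \sum_(x in Y) d x = \sum_(x in Y) dZ x.
  by apply: eq_bigr => x xY; rewrite dE dY0.
have e6 : \sum_(x in Z) d x = \sum_(x in Z) dY x + \sum_(x in Z) dZ x.
  by rewrite -big_split; apply: eq_bigr => x _; rewrite dE.
have e7 : 4 * (#|Y| * #|Z|) <= #|S| ^ 2 by rewrite -cardZ (nat_AGM2 #|Y| #|Z|).
rewrite !sumS; lia.
Qed.

Lemma johnson_connected (T : finType) (E A : {set T}) (P : {set T} -> Prop) :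
  A \subset E -> P A ->
  (forall (B : {set T}) a b, B \subset E -> P B -> a \in B -> b \in E :\: B -> P (b |: B :\ a)) ->
  forall B : {set T}, B \subset E -> #|B| = #|A| -> P B.
Proof.
move=> sAE PA step B sBE cBA.
have [m] := ubnP #|A :\: B|; elim: m A sAE PA cBA => // m IHm A sAE PA cBA.
have [|[a /setDP[aA aB]]] := set_0Vmem (A :\: B).
  move/eqP; rewrite setD_eq0 => sAB _.
  by have /eqP <- : A == B by rewrite eqEcard sAB cBA leqnn.
have [|[b /setDP[bB bA]]] := set_0Vmem (B :\: A).
  move/eqP; rewrite setD_eq0 => sBA; move: aB.
  have /eqP -> : B == A by rewrite eqEcard sBA cBA leqnn.
  by rewrite aA.
rewrite ltnS => ltm; apply: (IHm (b |: A :\ a)).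
- by rewrite subUset sub1set (subsetP sBE) //= (subset_trans (subD1set _ _)).
- by apply: step => //; rewrite inE bA (subsetP sBE).
- by rewrite cardsU1 !inE (negbTE bA) andbF cBA (cardsD1 a A) aA.
apply: leq_trans ltm; apply: proper_card; apply/properP; split.
  apply/subsetP => x; rewrite !inE => /andP[xB /orP[/eqP xb|/andP[_ xA]]].
    by rewrite xb bB in xB.
  by rewrite xB.
by exists a; rewrite !inE ?aA ?aB // eqxx /=; apply/norP; split=> //; apply: contraNneq aB => ->.
Qed.

Lemma exists_subset_card (T : finType) (S : {set T}) m :
  m <= #|S| -> exists2 A : {set T}, A \subset S & #|A| = m.
Proof.
rewrite -bin_gt0 -cards_draws card_gt0 => /set0Pn[A].
by rewrite inE => /andP[sAS /eqP cA]; exists A.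
Qed.

Lemma setU_setD (T : finType) (A S : {set T}) : A \subset S -> S = A :|: (S :\: A).
Proof. by move=> sAS; rewrite setDE setUIr setUCr setIT (setUidPr sAS). Qed.

Lemma disjoint_setD (T : finType) (A S : {set T}) : [disjoint A & S :\: A].
Proof. by rewrite disjoint_sym disjoints_subset setDE subsetIr. Qed.

Lemma odd_card_setU1 (T : finType) (v : T) (A G : {set T}) : v \notin A ->
  odd #|(v |: A) :&: G| = (v \in G) (+) odd #|A :&: G|.
Proof.
move=> vA; rewrite parity_setU ?disjoints1 //; congr (_ (+) _).
case vG: (v \in G); first by rewrite (setIidPl _) ?cards1 // sub1set.
by rewrite disjoint_setI0 ?cards0 // disjoints1 vG.
Qed.

(* Writing [S = C :|: D] with [#|D| = k], the sum of [f A] and of all [f (v |: D)],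
   [v \in A], does not change when an element of [A] is swapped for one of [E :\: A]. *)
Lemma additive_coloring (T : finType) (k : nat) (H f : {set {set T}}) (S E : {set T}) :
  #|S| = k.+1 + k -> #|E| = k.+1 + k.+1 -> [disjoint S & E] ->
  (forall P Q : {set T}, #|P| = k.+1 -> #|Q| = k.+1 -> [disjoint P & Q] ->
     P :|: Q \subset S :|: E -> (P :|: Q \in H) = (P \in f) (+) (Q \in f)) ->
  (E \in H) = odd #|E :&: [set v | v |: S \in H]|.
Proof.
move=> cS cE dSE Hf.
have [|C sCS cC] := @exists_subset_card T S k.+1; first by rewrite cS leq_addr.
pose D := S :\: C; have cD : #|D| = k by rewrite cardsD (setIidPr sCS) cS cC addKn.
have SE : S = C :|: D by exact: setU_setD.
have dCD : [disjoint C & D] by exact: disjoint_setD.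
have sDS : D \subset S := subsetDl _ _.
clearbody D.
have [|A sAE cA] := @exists_subset_card T E k.+1; first by rewrite cE leq_addr.
have notS v : v \in E -> v \notin S by move=> vE; rewrite (disjointFl dSE vE).
have notD v : v \in E -> v \notin D.
  by move=> /notS; apply: contra; exact: (subsetP sDS).
pose G := [set v | v |: D \in f].
pose F (B : {set T}) := (B \in f) (+) odd #|B :&: G|.
have constF (B : {set T}) : B \subset E -> #|B| = #|A| -> #|B| = k.+1 /\ F B = F A.
  apply: (johnson_connected (P := fun B : {set T} => #|B| = k.+1 /\ F B = F A) sAE) => // {}B a b sBE.
  move=> [cB <-] aB /setDP[bE bB]; have aE := subsetP sBE _ aB.
  pose X := B :\ a; have aX : a \notin X by rewrite !inE eqxx.
  have bX : b \notin X by rewrite !inE (negbTE bB) andbF.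
  have BE : B = a |: X by rewrite setD1K.
  have cX : #|X| = k by move: cB; rewrite (cardsD1 a) aB => -[].
  have sXE : X \subset E := subset_trans (subD1set _ _) sBE.
  have neq_ab : a != b by apply: contraNneq bB => <-.
  rewrite -/X; clearbody X.
  have dXD : [disjoint X & D].
    by rewrite disjoint_sym; apply: disjointWr sXE (disjointWl sDS dSE).
  split; first by rewrite cardsU1 bX cX.
  have cross x y : x \in E -> y \in E -> x \notin X -> y \notin X -> x != y ->
      ((x |: X) :|: (y |: D) \in H) = (x |: X \in f) (+) (y \in G).
    move=> xE yE xX yX nxy; rewrite Hf ?inE //.
    - by rewrite cardsU1 xX cX.
    - by rewrite cardsU1 notD // cD.
    - by rewrite disjoint_setU1 !inE negb_or nxy notD //= disjoint_sym disjoint_setU1 yX disjoint_sym.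
    apply/subsetP => z; rewrite !inE => /orP[/orP[/eqP->|]|/orP[/eqP->|]].
    + by rewrite xE orbT.
    + by move/(subsetP sXE) ->; rewrite orbT.
    + by rewrite yE orbT.
    + by move/(subsetP sDS) ->.
  have := cross a b aE bE aX bX neq_ab.
  rewrite (_ : (a |: X) :|: (b |: D) = (b |: X) :|: (a |: D)); last first.
    by rewrite setUACA [[set a] :|: _]setUC setUACA.
  rewrite cross 1?eq_sym // /F BE !odd_card_setU1 //.
  by do 4!case: (_ \in _); case: (odd _).
have sBE := subsetDl E A.
have cB : #|E :\: A| = k.+1 by rewrite cardsD (setIidPr sAE) cE cA addKn.
have EE : E = A :|: (E :\: A) by exact: setU_setD.
have dAB : [disjoint A & E :\: A] by exact: disjoint_setD.
have [_] := constF _ sBE (etrans cB (esym cA)).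
have HE : (E \in H) = (A \in f) (+) (E :\: A \in f).
  by rewrite {1}EE Hf // -EE subsetUr.
have oddEG : odd #|E :&: G| = odd #|A :&: G| (+) odd #|(E :\: A) :&: G|.
  by rewrite {1}EE parity_setU.
have memL v : v \in E -> (v |: S \in H) = (C \in f) (+) (v \in G).
  move=> vE; rewrite SE setUCA Hf ?inE //.
  - by rewrite cardsU1 notD // cD.
  - by rewrite disjoint_sym disjoint_setU1 disjoint_sym dCD andbT;
       apply: contra (notS v vE) => /(subsetP sCS).
  by rewrite setUCA -SE setUC setUS ?sub1set.
have -> : E :&: [set v | v |: S \in H] = if C \in f then E :\: G else E :&: G.
  apply/setP => v; case: ifP => Cf; rewrite !in_setI ?in_setD in_set;
    case vE: (v \in E); rewrite ?andbF //= memL // Cf //.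
  by rewrite andbT.
rewrite HE /F; suff -> : odd #|if C \in f then E :\: G else E :&: G| = odd #|E :&: G|.
  by rewrite oddEG; do 2!case: (_ \in _); do 2!case: (odd _).
case: ifP => // _; have := cardsID G E; rewrite cE addnn => /(congr1 odd).
by rewrite odd_double oddD; do 2!case: odd.
Qed.

Definition C3_free (T : finType) (q : nat) (H : {set {set T}}) : Prop :=
  {in ksets T q & &, forall P Q R, adj H P Q -> adj H P R -> adj H Q R -> False}.

Lemma exists_le_average (I : finType) (A : {set I}) (f : I -> nat) c :
  0 < #|A| -> \sum_(i in A) f i <= #|A| * c -> exists2 i, i \in A & f i <= c.
Proof.
move=> A0 le_sum; have /card_gt0P[i0 i0A] := A0.
have [i iA f_min] := arg_minnP f i0A; exists i => //.
rewrite -(leq_pmul2l A0); apply: leq_trans le_sum.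
by rewrite -sum_nat_const; apply: leq_sum.
Qed.

Section Stability.
Variables (T : finType) (k : nat).
Notation q := k.+1.
Notation n := #|T|.
Notation N := 'C(n, q).
Notation M := 'C(n.-1, k).
Notation K := 'C(q + q, q).

Lemma card_disjoint_ksets (A : {set T}) :
  N <= #|[set B in ksets T q | [disjoint A & B]]| + #|A| * M.
Proof.
rewrite -(card_ksets T q) -(cardsID [set B : {set T} | [disjoint A & B]] (ksets T q)).
apply: leq_add; first by apply: subset_leq_card; apply/subsetP => B; rewrite !inE.
rewrite (leq_trans _ (card_meeting k A)) //; apply: subset_leq_card.
by apply/subsetP => B; rewrite !inE disjoint_sym andbC.
Qed.

Lemma nbr_complete (A : {set T}) : #|A| = q ->
  nbr (ksets T (q + q)) q A = [set B in ksets T q | [disjoint A & B]].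
Proof.
move=> cA; apply/setP => B; rewrite !inE /adj; case: eqP => //= cB.
by case: (boolP [disjoint A & B]) => //= dAB; rewrite inE disjoint_card // cA cB eqxx.
Qed.

Lemma sum_nbr_complete :
  'C(n, q + q) * K = \sum_(A in ksets T q) #|[set B in ksets T q | [disjoint A & B]]|.
Proof.
rewrite -(card_ksets T) -sum_card_nbr => [|E]; last by rewrite inE => /eqP.
by apply: eq_bigr => A; rewrite inE => /eqP /nbr_complete ->.
Qed.

Lemma sqr_card_ksets_le : N * N <= 'C(n, q + q) * K + q * M * N.
Proof.
rewrite sum_nbr_complete [q * M * N]mulnC -{1 3}(card_ksets T q) -!sum_nat_const.
rewrite -big_split /=; apply: leq_sum => A; rewrite inE => /eqP cA.
by have := card_disjoint_ksets A; rewrite cA.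
Qed.

Lemma sqr_card_ksets_ge : 'C(n, q + q) * K <= N * N.
Proof.
rewrite sum_nbr_complete -{1}(card_ksets T q) -sum_nat_const; apply: leq_sum => A _.
by rewrite -(card_ksets T q) subset_leq_card //; apply/subsetP => B; rewrite inE => /andP[].
Qed.

Definition stability_const := 4 * q ^ 2 + 2 * q ^ 2 * 'C((q + k) + (q + q), q + k).

(* [U] is the link of a [(q + k)]-set [S] chosen by averaging. *)
Lemma stability (H : {set {set T}}) :
  {in H, forall E : {set T}, #|E| = q + q} -> C3_free q H -> 'C(n, q + q) <= 2 * #|H| ->
  q + k <= n ->
  exists U : {set T},
    n * #|H :\: parity_family (q + q) U| <= stability_const * N ^ 2.
Proof.
move=> Hr Hfree Hlarge len.
have [f mis_le] := mantel_stability (adj_sym H) Hfree.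
set mis := \sum_(A in _) _ in mis_le.
have mis_bound : n * mis <= 2 * q ^ 2 * N ^ 2.
  move: mis_le; rewrite -[X in 6 * X]/(\sum_(A in ksets T q) #|nbr H q A|).
  rewrite (sum_card_nbr Hr) card_ksets => mis_le.
  have le1 := sqr_card_ksets_le.
  have le2 : 'C(n, q + q) * K <= 2 * (#|H| * K) by rewrite mulnA leq_mul2r Hlarge orbT.
  have nM := mul_bin_diag n k.
  have : 2 * mis <= 3 * (q * M * N) by lia.
  rewrite -(leq_pmul2l (ltn0Sn n)) => le3.
  have : n * (2 * mis) <= n * (3 * (q * M * N)) by rewrite leq_mul2l; apply/orP; right; lia.
  have -> : n * (3 * (q * M * N)) = 3 * q * N * (n * M) by lia.
  rewrite nM; lia.
pose MP := [set p : {set T} * {set T} | [&& p.1 \in ksets T q, p.2 \in ksets T q,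
   [disjoint p.1 & p.2] & (p.1 :|: p.2 \in H) != (p.1 \in f) (+) (p.2 \in f)]].
have cMP : #|MP| <= mis.
  rewrite /mis -sum1_card.
  rewrite (eq_bigr (fun A =>
    \sum_(B in [set B in ksets T q | adj H A B != ((A \in f) != (B \in f))]) 1)); last first.
    by move=> A _; rewrite sum1_card.
  rewrite pair_big_dep /= [leqLHS]big_mkcond [leqRHS]big_mkcond /=; apply: leq_sum => -[A B] _ /=.
  rewrite !inE /= /adj; case: (#|A| == _); case: (#|B| == _) => //=.
  by case: [disjoint A & B] => //=; rewrite -negb_eqb.
pose W := [set X in ksets T (q + k + (q + q)) | [exists p in MP, p.1 :|: p.2 \subset X]].
have cW : #|W| <= #|MP| * 'C(n, q + k).
  rewrite -sum_nat_const.
  apply: (@leq_trans (\sum_(p in MP) #|[set X in ksets T (q + k + (q + q)) | p.1 :|: p.2 \subset X]|)).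
    rewrite double_count -sum1_card big_mkcond [leqRHS]big_mkcond /=.
    apply: leq_sum => X _; rewrite !in_set; case: ifP => // /andP[-> /existsP[p pP]].
    by rewrite card_gt0; apply/set0Pn; exists p; rewrite inE.
  apply: leq_sum => -[P Q]; rewrite inE /= => /and4P[+ + dPQ _]; rewrite !inE => /eqP cP /eqP cQ.
  by apply: leq_trans (card_supersets _ _) _; rewrite disjoint_card // cP cQ addnK.
have [S] : exists2 S, S \in ksets T (q + k) &
    #|nbr W (q + q) S| <= #|MP| * 'C((q + k) + (q + q), q + k).
  apply: exists_le_average; first by rewrite card_ksets bin_gt0.
  rewrite sum_card_nbr => [|X]; last by rewrite !inE => /andP[/eqP].
  by rewrite card_ksets mulnA leq_mul2r [_ * #|MP|]mulnC cW orbT.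
rewrite inE => /eqP cS nbrS; pose U := [set v | v |: S \in H]; exists U.
have sub : H :\: parity_family (q + q) U \subset
    [set E in ksets T (q + q) | ~~ [disjoint E & S]] :|: nbr W (q + q) S.
  apply/subsetP => E; rewrite !inE => /andP[nodd EH]; move: nodd.
  rewrite (Hr _ EH) eqxx /= => nodd; have [dES /=|//] := boolP [disjoint E & S].
  apply: contraR nodd => nadj; rewrite -(@additive_coloring T k H f S E cS (Hr _ EH)) 1?disjoint_sym //.
  move=> P Q cP cQ dPQ sPQ; apply/eqP; apply: contraR nadj => neq.
    rewrite /adj disjoint_sym dES inE; apply/andP; split=> //.
    rewrite inE disjoint_card 1?disjoint_sym // cS Hr // eqxx /=.
    by apply/existsP; exists (P, Q); rewrite /= sPQ !inE cP cQ eqxx dPQ neq.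
have le_card := leq_trans (subset_leq_card sub) (leq_card_setU _ _).
have := card_meeting (q + k) S; rewrite -addnS cS => meet.
have nC := mul_bin_diag n (q + k); rewrite -addnS in nC.
have CN : 'C(n, q + q) <= N ^ 2.
  by rewrite -mulnn (leq_trans _ sqr_card_ksets_ge) // leq_pmulr // bin_gt0 leq_addr.
have step1 : n * #|H :\: parity_family (q + q) U| <=
   (q + k) * ((q + q) * N ^ 2) + 'C((q + k) + (q + q), q + k) * (2 * q ^ 2 * N ^ 2).
  apply: (@leq_trans (n * ((q + k) * 'C(n.-1, q + k) + mis * 'C((q + k) + (q + q), q + k)))).
    rewrite leq_mul2l; apply/orP; right; apply: leq_trans le_card _.
    by apply: leq_add => //; apply: leq_trans nbrS _; rewrite leq_mul2r cMP orbT.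
  rewrite mulnDr; apply: leq_add.
    by rewrite mulnCA nC leq_mul2l leq_mul2l CN !orbT.
  by rewrite mulnA mulnC leq_mul2l mis_bound orbT.
apply: leq_trans step1 _; rewrite /stability_const [leqRHS]mulnDl.
rewrite [2 * q ^ 2 * _ * _]mulnAC [2 * q ^ 2 * _ * _]mulnC leq_add2r mulnA leq_mul2r.
by apply/orP; right; rewrite -mulnn; lia.
Qed.

End Stability.

(** * From approximate to exact structure *)

Lemma card_bigcup_le (I T : finType) (A : {set I}) (F : I -> {set T}) :
  #|\bigcup_(i in A) F i| <= \sum_(i in A) #|F i|.
Proof.
elim/big_ind2: _ => [|X x Y y leX leY|//]; first by rewrite cards0.
  by apply: leq_trans (leq_add leX leY); exact: leq_card_setU.
Qed.

Lemma exists_flip (T : finType) (U : {set T}) v :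
  exists U' : {set T}, forall E : {set T}, odd #|E :&: U'| = odd #|E :&: U| (+) (v \in E).
Proof.
have flip (W E : {set T}) : v \notin W -> odd #|E :&: (v |: W)| = odd #|E :&: W| (+) (v \in E).
  by move=> vW; rewrite setIC odd_card_setU1 // [W :&: E]setIC addbC.
have [vU|vU] := boolP (v \in U); last by exists (v |: U) => E; apply: flip.
exists (U :\ v) => E; rewrite -{2}(setD1K vU) flip ?inE ?eqxx // addbK //.
Qed.

(* If [A] in [F] met no member of [F] in exactly one point, then [F] would be closed
   under swaps, since the complement of a swap of [A] meets [A] in one point. *)
Lemma two_sets_meeting_once (T : finType) (k : nat) (E : {set T}) (F : {set {set T}}) :
  #|E| = k.+1 + k.+1 ->
  (forall A : {set T}, A \subset E -> #|A| = k.+1 -> (A \in F) || (E :\: A \in F)) ->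
  exists A B : {set T}, [/\ A \in F, B \in F, A \subset E, B \subset E & #|A :&: B| = 1].
Proof.
move=> cE half; have cD (A : {set T}) : A \subset E -> #|A| = k.+1 -> #|E :\: A| = k.+1.
  by move=> sA cA; rewrite cardsD (setIidPr sA) cE cA addKn.
have [A sAE [cA AF]] : exists2 A : {set T}, A \subset E & #|A| = k.+1 /\ A \in F.
  have [|A sAE cA] := @exists_subset_card T E k.+1; first by rewrite cE leq_addr.
  by have /orP[AF|AF] := half A sAE cA; [exists A|exists (E :\: A)]; rewrite ?subsetDl ?cD.
have meet (B : {set T}) a b : a \in B -> b \in E :\: B -> B :&: (a |: (E :\: B) :\ b) = [set a].
  move=> aB /setDP[bE bB]; apply/setP => x; rewrite !inE.
  by have [->|/=] := eqVneq x a; rewrite ?aB //; case: (x \in B); rewrite ?andbF.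
case: (boolP [exists X in F, exists Y in F,
    [&& X \subset E, Y \subset E & #|X :&: Y| == 1]])
  => [/exists_inP[X XF /exists_inP[Y YF /and3P[sX sY /eqP cXY]]]|none].
  by exists X, Y.
exfalso; have {}none X Y : X \in F -> Y \in F -> X \subset E -> Y \subset E -> #|X :&: Y| <> 1.
  move=> XF YF sX sY cXY; case/negP: none; apply/exists_inP; exists X => //.
  by apply/exists_inP; exists Y => //; rewrite sX sY cXY.
have swap_sub (B : {set T}) a b : a \in E -> B \subset E -> a |: B :\ b \subset E.
  by move=> aE sB; rewrite subUset sub1set aE (subset_trans (subD1set _ _)).
have swap_card (B : {set T}) a b : a \notin B -> b \in B -> #|a |: B :\ b| = #|B|.
  by move=> aB bB; rewrite cardsU1 !inE (negbTE aB) andbF (cardsD1 b B) bB.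
have all_in (B : {set T}) : B \subset E -> #|B| = #|A| -> #|B| = k.+1 /\ B \in F.
  apply: (johnson_connected (P := fun B : {set T} => #|B| = k.+1 /\ B \in F) sAE) => //.
  move=> {}B a b sB [cB BF] aB bB; have /setDP[bE nbB] := bB.
  have aE := subsetP sB _ aB.
  split; first by rewrite swap_card.
  have [//|] := orP (half _ (swap_sub B b a bE sB) (etrans (swap_card B b a nbB aB) cB)).
  have -> : E :\: (b |: B :\ a) = a |: (E :\: B) :\ b.
    have nab : a != b by apply: contraNneq nbB => <-.
    apply/setP => x; rewrite !inE; have [->|_] := eqVneq x a; first by rewrite (negbTE nab) aE.
    by rewrite negb_or -andbA.
  move=> inF; case: (none B _ BF inF sB _); last by rewrite meet // cards1.
  by apply: swap_sub => //; apply: subsetDl.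
have /card_gt0P[a aA] : 0 < #|A| by rewrite cA.
have /card_gt0P[b bA] : 0 < #|E :\: A| by rewrite cD.
have aD : a \notin E :\: A by rewrite inE aA.
have aE := subsetP sAE _ aA.
have sB := swap_sub (E :\: A) a b aE (subsetDl _ _).
have [|_ BF] := all_in _ sB; first by rewrite swap_card // cD.
by apply: (none A _ AF BF sAE sB); rewrite meet // cards1.
Qed.

Lemma balanced_of_product x y s P m :
  0 < m -> m * (x + y) ^ 2 <= 4 * m * (x * y) + s * (x + y) ^ 2 -> P ^ 2 * s <= m ->
  2 * P * x <= (P + 1) * (x + y).
Proof.
move=> m0 le1 le2; have [lexy|ltyx] := leqP x y; first by nia.
pose d := x - y; have xE : x = y + d by rewrite subnKC // ltnW.
have le3 : m * d ^ 2 <= s * (x + y) ^ 2.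
  have -> : m * d ^ 2 = m * (x + y) ^ 2 - 4 * m * (x * y).
    by rewrite xE -!mulnn; lia.
  by rewrite leq_subLR.
have : P ^ 2 * (m * d ^ 2) <= m * (x + y) ^ 2.
  apply: leq_trans (_ : P ^ 2 * (s * (x + y) ^ 2) <= _); first by rewrite leq_mul2l le3 orbT.
  by rewrite mulnA leq_mul2r le2 orbT.
rewrite mulnCA leq_pmul2l // -expnMn leq_sqr; lia.
Qed.

Section NearExtremal.
Variables (T : finType) (k : nat) (H : {set {set T}}) (U : {set T}) (c L : nat).
Notation q := k.+1.
Notation n := #|T|.
Notation N := 'C(n, q).
Notation M := 'C(n.-1, k).
Notation K := 'C(q + q, q).
Notation PF := (parity_family (q + q)).
Notation P := (16 * L ^ 2).

Hypothesis Hr : {in H, forall E : {set T}, #|E| = q + q}.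
Hypothesis Hfree : C3_free q H.
Hypothesis Hlarge : 'C(n, q + q) <= 2 * #|H|.
Hypothesis Hdeg : forall v, 'C(n.-1, k + q) <= 2 * #|star H v|.
Hypothesis Hmax : forall U', #|H :&: PF U'| <= #|H :&: PF U|.
Hypothesis Hopt : #|PF U| <= #|H|.
Hypothesis bad_le : n * #|H :\: PF U| <= c * N ^ 2.
Hypothesis L_large : 128 * q ^ 2 * K < L.
Hypothesis n_large : P ^ 2 * (2 * K * c + 4 * q ^ 2) <= n.

Definition bad := H :\: PF U.
Definition good := H :&: PF U.
Definition missing := PF U :\: H.
Definition par (A : {set T}) := odd #|A :&: U|.
Definition parity_class b : {set {set T}} := [set B in ksets T q | par B == b].

Lemma L_gt0 : 0 < L. Proof. exact: leq_ltn_trans L_large. Qed.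

Lemma K_gt0 : 0 < K. Proof. by rewrite bin_gt0 leq_addr. Qed.

Lemma n_lower_bounds : 16 * L ^ 2 * (16 * q ^ 2) <= n /\ 2 * (k + q) <= n /\ 0 < n.
Proof.
have L0 := L_gt0; have L20 : 0 < L ^ 2 by rewrite expn_gt0 L0.
have : 16 * L ^ 2 * (16 * q ^ 2) <= n.
  apply: leq_trans n_large; move: (q ^ 2) (2 * K * c) (L ^ 2) L20 => Q X l l0.
  by have := leq_pmulr (l * Q) l0; rewrite -mulnn; nia.
move=> le; split=> //; have : 16 * q ^ 2 <= n by apply: leq_trans le; rewrite leq_pmull // muln_gt0.
by rewrite -mulnn; lia.
Qed.

Lemma N_gt0 : 0 < N.
Proof. by rewrite bin_gt0; have [_ [+ _]] := n_lower_bounds; lia. Qed.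

Lemma mul_card_star : n * M = q * N. Proof. exact: mul_bin_diag. Qed.

Lemma qM_small : P * (16 * (q * M)) <= N.
Proof.
have [le [_ n0]] := n_lower_bounds; rewrite -(leq_pmul2l n0).
have -> : n * (P * (16 * (q * M))) = P * (16 * (q * (n * M))) by lia.
rewrite mul_card_star; apply: leq_trans (leq_mul le (leqnn N)).
by rewrite -!mulnn; lia.
Qed.

Lemma in_parity_family (E W : {set T}) : (E \in PF W) = (#|E| == q + q) && odd #|E :&: W|.
Proof. by rewrite !inE. Qed.

Lemma missing_le_bad : #|missing| <= #|bad|.
Proof.
rewrite /missing /bad !cardsD [_ :&: H]setIC; exact: leq_sub2r.
Qed.

Lemma card_good_bad : #|good| + #|bad| = #|H|.
Proof. exact: cardsID. Qed.

Lemma nbr_split (A : {set T}) : #|nbr H q A| = #|nbr bad q A| + #|nbr good q A|.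
Proof.
rewrite addnC -(cardsID [set B : {set T} | A :|: B \in PF U]); congr (_ + _).
  by apply: eq_card => B; rewrite !inE /adj !inE !andbA.
by apply: eq_card => B; rewrite !inE /adj !inE; case: (#|B| == _); case: [disjoint _ & _];
  case: (_ \in H); rewrite ?andbF ?andbT.
Qed.

Lemma nbr_parity (F : {set {set T}}) b (A B : {set T}) : #|A| = q ->
  {in F, forall E : {set T}, #|E| = q + q -> odd #|E :&: U| = b} ->
  B \in nbr F q A -> par B = b (+) par A.
Proof.
move=> cA Fb; rewrite inE => /andP[]; rewrite inE => /eqP cB /andP[dAB AB].
have := Fb _ AB; rewrite disjoint_card // cA cB => /(_ erefl).
by rewrite parity_setU // /par => <-; case: odd; case: odd.
Qed.

Lemma nbr_bad_parity (A B : {set T}) : #|A| = q -> B \in nbr bad q A -> par B = par A.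
Proof.
move=> cA /(nbr_parity (b := false) cA) -> // E; rewrite in_setD in_parity_family.
by move=> /andP[+ _] cE; rewrite cE eqxx /= => /negbTE.
Qed.

Lemma nbr_good_parity (A B : {set T}) : #|A| = q -> B \in nbr good q A -> par B = ~~ par A.
Proof.
move=> cA /(nbr_parity (b := true) cA) -> // E; rewrite in_setI in_parity_family.
by move=> /andP[_ /andP[]].
Qed.

Lemma nbr_missing_parity (A B : {set T}) : #|A| = q -> B \in nbr missing q A -> par B = ~~ par A.
Proof.
move=> cA /(nbr_parity (b := true) cA) -> // E; rewrite in_setD in_parity_family.
by move=> /andP[_ /andP[]].
Qed.

Lemma in_parity_class (B : {set T}) b :
  (B \in parity_class b) = (B \in ksets T q) && (par B == b).
Proof. by rewrite [LHS]in_set. Qed.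

Lemma card_parity_class b : #|parity_class b| + #|parity_class (~~ b)| = N.
Proof.
rewrite -(card_ksets T q) -(cardsID [set B : {set T} | par B == b] (ksets T q)).
apply: f_equal2; apply: eq_card => B; rewrite in_parity_class.
  by rewrite in_setI [X in _ = _ && X]in_set.
by rewrite in_setD [X in _ = ~~ X && _]in_set andbC; case: (par B); case: (b).
Qed.

Lemma nbr_good_le (A : {set T}) : #|A| = q ->
  #|nbr missing q A| + #|nbr good q A| <= #|parity_class (~~ par A)|.
Proof.
move=> cA; rewrite -cardsUI; set I := _ :&: _; have -> : I = set0.
  apply/setP => B; rewrite !inE /adj !inE; case: (A :|: B \in H); rewrite ?andbF //.
rewrite cards0 addn0; apply: subset_leq_card; apply/subsetP => B; rewrite in_setU.
rewrite in_parity_class; case/orP => inB.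
  by rewrite (nbr_missing_parity cA inB) eqxx andbT; move: inB; rewrite inE => /andP[].
by rewrite (nbr_good_parity cA inB) eqxx andbT; move: inB; rewrite inE => /andP[].
Qed.

Lemma sum_nbr (F : {set {set T}}) : {in F, forall E : {set T}, #|E| = q + q} ->
  \sum_(A in ksets T q) #|nbr F q A| = #|F| * K.
Proof. exact: sum_card_nbr. Qed.

Lemma uniform_good : {in good, forall E : {set T}, #|E| = q + q}.
Proof. by move=> E; rewrite inE => /andP[/Hr]. Qed.

Lemma uniform_bad : {in bad, forall E : {set T}, #|E| = q + q}.
Proof. by move=> E; rewrite inE => /andP[_ /Hr]. Qed.

Lemma uniform_missing : {in missing, forall E : {set T}, #|E| = q + q}.
Proof. by move=> E; rewrite inE in_parity_family => /andP[_ /andP[/eqP]]. Qed.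

Lemma parity_balanced b : 2 * P * #|parity_class b| <= (P + 1) * N.
Proof.
have [_ [_ n0]] := n_lower_bounds.
have goodK : #|good| * K <= 2 * (#|parity_class b| * #|parity_class (~~ b)|).
  rewrite -(sum_nbr uniform_good).
  apply: leq_trans (_ : \sum_(A in ksets T q) #|parity_class (~~ par A)| <= _).
    apply: leq_sum => A; rewrite inE => /eqP /nbr_good_le; exact/leq_trans/leq_addl.
  rewrite (bigID (fun A => par A == b)) /= mul2n -addnn; apply: leq_add.
    rewrite -sum_nat_const [leqRHS](eq_bigl (fun A => (A \in ksets T q) && (par A == b))); last first.
      by move=> A; rewrite [LHS]inE.
    by apply: leq_sum => A /andP[_ /eqP ->].
  rewrite mulnC -sum_nat_const [leqRHS](eq_bigl (fun A => (A \in ksets T q) && (par A != b))).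
    by apply: leq_sum => A /andP[_]; case: (par A); case: b.
  by move=> A; rewrite [LHS]inE; case: (par A); case: b.
rewrite -(card_parity_class b).
apply: (@balanced_of_product _ _ (2 * K * c + q ^ 2) P n) => //; last first.
  by apply: leq_trans n_large; rewrite leq_mul2l leq_add2l leq_pmull ?orbT.
rewrite card_parity_class.
have le1 : N * N <= 4 * (#|parity_class b| * #|parity_class (~~ b)|) + 2 * K * #|bad| + q * M * N.
  apply: leq_trans (sqr_card_ksets_le T k) _; rewrite leq_add2r.
  apply: leq_trans (_ : 2 * #|H| * K <= _); first by rewrite leq_mul2r Hlarge orbT.
  by rewrite -card_good_bad; lia.
have le2 : 2 * K * (n * #|bad|) <= 2 * K * (c * N ^ 2) by rewrite leq_mul2l bad_le orbT.
have := leq_mul (leqnn n) le1; rewrite mulnn => /leq_trans; apply.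
have -> : n * (4 * (#|parity_class b| * #|parity_class (~~ b)|) + 2 * K * #|bad| + q * M * N)
  = 4 * n * (#|parity_class b| * #|parity_class (~~ b)|) + (2 * K * (n * #|bad|) + q * (n * M) * N) by lia.
rewrite leq_add2l mul_card_star mulnDl; apply: leq_add; first by rewrite -[leqRHS]mulnA.
by rewrite -!mulnn; lia.
Qed.

Lemma bad_or_good_small (A : {set T}) : #|A| = q ->
  (P * #|nbr bad q A| <= N) || (P * #|nbr good q A| <= N).
Proof.
move=> cA; have [_ [_ n0]] := n_lower_bounds; apply: contraT; rewrite negb_or -!ltnNge => /andP[ltb ltg].
have prod_le : #|nbr bad q A| * #|nbr good q A| <= #|missing| * K + N * (q * M).
  apply: leq_trans (_ : \sum_(B in ksets T q) (#|nbr missing q B| + q * M) <= _); last first.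
    by rewrite big_split /= sum_nat_const card_ksets (sum_nbr uniform_missing).
  rewrite -sum_nat_const big_mkcond [leqRHS]big_mkcond /=; apply: leq_sum => B _.
  case: ifP => // inb; have pB := nbr_bad_parity cA inb; move: inb.
  rewrite in_set => /andP[Bq /andP[dAB]]; rewrite in_setD => /andP[_ ABH]; rewrite Bq.
  have cB : #|B| = q by move: Bq; rewrite inE => /eqP.
  apply: leq_trans (_ : #|nbr missing q B :|: [set C in ksets T q | ~~ [disjoint C & B]]| <= _).
    apply: subset_leq_card; apply/subsetP => C inC; have pC := nbr_good_parity cA inC; move: inC.
    rewrite in_set => /andP[Cq /andP[dAC]]; rewrite in_setI => /andP[ACH _].
    rewrite in_setU [X in X || _]in_set [X in _ || X]in_set Cq /= [X in _ || ~~ X]disjoint_sym orbC.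
    have cC : #|C| = q by move: Cq; rewrite inE => /eqP.
    have [dBC /=|//] := boolP [disjoint B & C].
    rewrite /adj dBC in_setD in_parity_family disjoint_card // cB cC eqxx parity_setU //.
    rewrite -/(par B) -/(par C) pB pC /=; apply/andP; split; last by case: (par A).
    have Aq : A \in ksets T q by rewrite in_set cA.
    by apply/negP => BCH; apply: (Hfree Aq Bq Cq); rewrite /adj ?dAB ?dAC ?dBC.
  apply: leq_trans (leq_card_setU _ _) _; rewrite leq_add2l.
  by have := card_meeting k B; rewrite cB.
have le3 : n * (#|nbr bad q A| * #|nbr good q A|) <= (K * c + q ^ 2) * N ^ 2.
  have := leq_mul (leqnn n) prod_le => /leq_trans; apply.
  have -> : n * (#|missing| * K + N * (q * M)) = K * (n * #|missing|) + q * N * (n * M) by lia.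
  rewrite mul_card_star mulnDl; apply: leq_add; last by rewrite -!mulnn; lia.
  rewrite -mulnA leq_mul2l; apply/orP; right; apply: leq_trans bad_le.
  by rewrite leq_mul2l missing_le_bad orbT.
have : n * N ^ 2 < n * (P ^ 2 * (#|nbr bad q A| * #|nbr good q A|)).
  rewrite ltn_pmul2l // -!mulnn.
  have := leq_mul ltb ltg; nia.
rewrite mulnCA ltnNge => /negP[]; apply: leq_trans (_ : P ^ 2 * ((K * c + q ^ 2) * N ^ 2) <= _).
  by rewrite leq_mul2l le3 orbT.
rewrite mulnA leq_mul2r; apply/orP; right; apply: leq_trans n_large.
by rewrite leq_mul2l; apply/orP; right; lia.
Qed.

Lemma star_bad_le_good v : #|star bad v| <= #|star good v|.
Proof.
have [U' flip] := exists_flip U v.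
have := Hmax U'; rewrite -/good -(leq_add2r #|star good v|) => le.
have eq : #|H :&: PF U'| + #|star good v| = #|good| + #|star bad v|.
  have -> : H :&: PF U' = (good :\: star good v) :|: star bad v.
    apply/setP => E; rewrite in_setI in_setU in_setD in_setI !in_set flip.
    case EH: (E \in H); rewrite ?andbF //= (Hr EH) eqxx /=.
    by case: odd; case: (v \in E).
  rewrite disjoint_card; last first.
    rewrite -setI_eq0; apply/eqP/setP => E; rewrite in_setI in_setD in_setI !in_set.
    by case: (v \in E); case: (E \in H); case: (_ == _); case: odd; rewrite ?andbF.
  have sub : star good v \subset good by apply/subsetP => E; rewrite in_set => /andP[].
  by rewrite cardsD (setIidPr sub) addnAC subnK // subset_leq_card.
by move: le; rewrite eq leq_add2l.
Qed.

Definition avoiding v : {set {set T}} := [set A in ksets T k | v \notin A].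

Lemma card_avoiding v : #|avoiding v| = M.
Proof.
rewrite -(card_star_ksets k v) -card_link; apply: eq_card => A; rewrite !inE andbC.
by case vA: (v \in A) => //=; rewrite cardsU1 vA eqSS.
Qed.

Lemma card_setU1_avoiding v A : A \in avoiding v -> #|v |: A| = q.
Proof. by rewrite !inE => /andP[/eqP cA vA]; rewrite cardsU1 vA cA. Qed.

Lemma sum_avoiding (F : {set {set T}}) v : {in F, forall E : {set T}, #|E| = q + q} ->
  \sum_(A in avoiding v) #|nbr F q (v |: A)| = #|star F v| * 'C(k + q, k).
Proof.
move=> Fr; rewrite -sum_star_nbr //.
by apply: eq_bigl => A; rewrite [LHS]inE.
Qed.

Lemma sum_nbr_avoiding_ge v :
  (P - 1) * (M * N) <= 2 * P * \sum_(A in avoiding v) #|nbr H q (v |: A)|.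
Proof.
have le1 : M * N <= 'C(n.-1, k + q) * 'C(k + q, k) + M * (q * M).
  have -> : 'C(n.-1, k + q) = #|star (ksets T (q + q)) v| by rewrite card_star_ksets.
  rewrite -sum_avoiding => [|E]; last by rewrite inE => /eqP.
  rewrite -{1 2}(card_avoiding v) -!sum_nat_const -big_split /=; apply: leq_sum => A inA.
  have cA := card_setU1_avoiding inA; rewrite nbr_complete //.
  by have := card_disjoint_ksets k (v |: A); rewrite cA.
have le2 : 'C(n.-1, k + q) * 'C(k + q, k) <= 2 * \sum_(A in avoiding v) #|nbr H q (v |: A)|.
  by rewrite sum_avoiding // mulnA leq_mul2r Hdeg orbT.
have le3 : P * (q * M) <= N by have := qM_small; lia.
have := leq_mul (leqnn P) (leq_trans le1 (leq_add le2 (leqnn _))).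
have := leq_mul (leqnn M) le3; rewrite mulnBl mul1n => h1 h2.
rewrite leq_subLR; apply: leq_trans h2 _; lia.
Qed.

Lemma in_nbr (F : {set {set T}}) (A B : {set T}) :
  (B \in nbr F q A) = (B \in ksets T q) && adj F A B.
Proof. by rewrite [LHS]in_set. Qed.

Lemma adj_bad (A B : {set T}) : A \in ksets T q -> B \in ksets T q ->
  adj bad A B = adj H A B && (par B == par A).
Proof.
rewrite !in_set => /eqP cA /eqP cB; rewrite /adj in_setD in_parity_family.
case: (boolP [disjoint A & B]) => //= dAB; rewrite disjoint_card // cA cB eqxx parity_setU //=.
by rewrite /par andbC; case: odd; case: odd.
Qed.

Lemma adj_good (A B : {set T}) : A \in ksets T q -> B \in ksets T q ->
  adj good A B = adj H A B && (par B != par A).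
Proof.
rewrite !in_set => /eqP cA /eqP cB; rewrite /adj in_setI in_parity_family.
case: (boolP [disjoint A & B]) => //= dAB; rewrite disjoint_card // cA cB eqxx parity_setU //=.
by rewrite /par; case: odd; case: odd.
Qed.

Definition fault b A : {set {set T}} :=
  [set B in ksets T q | (adj H A B == (par B == par A)) == b].

Lemma card_fault b (A : {set T}) : #|A| = q ->
  #|fault b A| + #|nbr (if b then good else bad) q A|
    <= #|parity_class (b (+) par A)| + #|nbr (if b then bad else good) q A|.
Proof.
move=> cA; have Aq : A \in ksets T q by rewrite in_set cA.
set F1 := nbr _ q A; set F2 := nbr _ q A.
have sub : F1 \subset parity_class (b (+) par A).
  apply/subsetP => B; rewrite in_nbr in_parity_class => /andP[Bq]; rewrite Bq.
  by case: (b); rewrite ?adj_good ?adj_bad // => /andP[_]; case: (par B); case: (par A).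
have : #|fault b A| <= #|(parity_class (b (+) par A) :\: F1) :|: F2|.
  apply: subset_leq_card; apply/subsetP => B.
  rewrite in_setU in_setD !in_nbr in_parity_class [B \in fault _ _]in_set.
  case Bq: (B \in ksets T q) => //=.
  by case: (b); rewrite adj_good ?adj_bad //; case: adj; case: (par B); case: (par A).
move=> /leq_trans/(_ (leq_card_setU _ _)); rewrite cardsD (setIidPr sub) => le.
have := subset_leq_card sub; lia.
Qed.

Lemma sum_extensions_le (F X : {set {set T}}) : {in F, forall E : {set T}, #|E| = q} ->
  \sum_(B in X) #|[set x | (x \notin B) && (x |: B \in F)]| <= #|F| * q.
Proof.
move=> Fq; rewrite -(sum_star Fq).
have -> : \sum_v #|star F v| =
    \sum_(v in [set: T]) #|[set B in [set: {set T}] | (v \notin B) && (v |: B \in F)]|.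
  apply: eq_big => [v|v _]; first by rewrite in_setT.
  by rewrite -card_link; apply: eq_card => B; rewrite !in_set.
rewrite -double_count [leqLHS]big_mkcond [leqRHS]big_mkcond /=; apply: leq_sum => B _.
by rewrite in_setT; case: ifP => // _; apply: subset_leq_card; apply/subsetP => x; rewrite !in_set.
Qed.

(* Otherwise many (k-1)-sets [A] have many bad neighbours and many [B] have many good
   ones.  For a further point [x], the pairs [v |: A, x |: B] and [v |: B, x |: A] have
   the same union and the same parity relation, so one of them contradicts the
   behaviour predicted by [A] or by [B]. *)
Lemma sum_bad_small v : L * \sum_(A in avoiding v) #|nbr bad q (v |: A)| <= M * N.
Proof.
pose Db A := #|nbr bad q (v |: A)|; pose Dg A := #|nbr good q (v |: A)|.
rewrite -/(\sum_(A in avoiding v) Db A) leqNgt; apply/negP => large.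
have L0 := L_gt0; have P0 : 0 < P by rewrite muln_gt0 expn_gt0 L0.
have N0 := N_gt0.
pose Ab := [set A in avoiding v | N < P * Db A].
pose Ag := [set A in avoiding v | N < P * Dg A].
have bg : \sum_(A in avoiding v) Db A <= \sum_(A in avoiding v) Dg A.
  by rewrite !sum_avoiding ?leq_mul2r ?star_bad_le_good ?orbT //; [apply: uniform_good|apply: uniform_bad].
have nbr_le (F : {set {set T}}) B : #|nbr F q B| <= N.
  by rewrite -(card_ksets T q) subset_leq_card //; apply/subsetP => C; rewrite inE => /andP[].
have many (D : {set T} -> nat) : (forall A, D A <= N) ->
    M * N < L * \sum_(A in avoiding v) D A ->
    15 * M <= 16 * (L * #|[set A in avoiding v | N < P * D A]|).
  move=> DN lt; set X := [set A in _ | _].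
  have inX A : (A \in X) = (A \in avoiding v) && (N < P * D A) by rewrite [LHS]in_set.
  have : P * \sum_(A in avoiding v) D A <= P * N * #|X| + N * M.
    rewrite -(card_avoiding v) ![_ * #|_|]mulnC -!sum_nat_const big_distrr /=.
    rewrite [X in _ <= X + _](_ : _ = \sum_(A in avoiding v) if A \in X then P * N else 0).
      rewrite -big_split /=; apply: leq_sum => A inA; rewrite inX inA /=.
      case: ltnP => [_|//]; apply: leq_trans (leq_addr _ _).
      by rewrite leq_mul2l DN orbT.
    by rewrite -big_mkcondr /=; apply: eq_bigl => A; rewrite inX andbA andbb.
  move=> le.
  have : P * (M * N) < L * (P * N * #|X| + N * M).
    apply: leq_trans (_ : P * (L * \sum_(A in avoiding v) D A) <= _); first by rewrite ltn_pmul2l.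
    by rewrite mulnCA leq_mul2l le orbT.
  have -> : P * (M * N) = L * N * (16 * L * M) by rewrite -mulnn; lia.
  have -> : L * (P * N * #|X| + N * M) = L * N * (P * #|X| + M) by lia.
  rewrite ltn_pmul2l ?muln_gt0 ?L0 // => /ltnW.
  have : M <= L * M by rewrite leq_pmull.
  rewrite -mulnn => h1 h2; rewrite -(leq_pmul2l L0).
  lia.
have manyb : 15 * M <= 16 * (L * #|Ab|) by apply: many => // A; apply: nbr_le.
have manyg : 15 * M <= 16 * (L * #|Ag|).
  apply: many => [A|]; first exact: nbr_le.
  by apply: leq_trans large _; rewrite leq_mul2l bg orbT.
have inAb A : (A \in Ab) = (A \in avoiding v) && (N < P * Db A) by rewrite [LHS]in_set.
have inAg A : (A \in Ag) = (A \in avoiding v) && (N < P * Dg A) by rewrite [LHS]in_set.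
have cA A : A \in avoiding v -> #|v |: A| = q by exact: card_setU1_avoiding.
pose cost A := (if A \in Ab then #|fault false (v |: A)| else 0)
  + (if A \in Ag then #|fault true (v |: A)| else 0).
have cost_le A : A \in avoiding v -> 2 * P * (cost A + #|nbr H q (v |: A)|) <= (P + 5) * N.
  move=> inA; rewrite /cost nbr_split -/(Db A) -/(Dg A) inAb inAg inA /=.
  have f1 := card_fault false (cA A inA); have f2 := card_fault true (cA A inA).
  rewrite /= -/(Db A) -/(Dg A) in f1 f2.
  have b1 := parity_balanced (par (v |: A)); have b2 := parity_balanced (~~ par (v |: A)).
  have sm := bad_or_good_small (cA A inA); rewrite -/(Db A) -/(Dg A) in sm.
  have {}b1 : P * #|parity_class (par (v |: A))| * 2 <= P * N + N by lia.
  have {}b2 : P * #|parity_class (~~ par (v |: A))| * 2 <= P * N + N by lia.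
  have {}f1 := leq_mul (leqnn P) f1; have {}f2 := leq_mul (leqnn P) f2.
  move: sm f1 f2 b1 b2; move: (P) (N) (Db A) (Dg A) => p m d1 d2.
  move: (#|fault _ _|) (#|fault _ _|) (#|parity_class _|) (#|parity_class _|) => f1 f2 c1 c2.
  case: (ltnP m (p * d1)) => h1; case: (ltnP m (p * d2)) => h2 //= _.
  - lia.
  - lia.
  - lia.
have cost_sum : 2 * P * \sum_(A in avoiding v) cost A <= 6 * (M * N).
  have : \sum_(A in avoiding v) 2 * P * (cost A + #|nbr H q (v |: A)|) <= (P + 5) * N * M.
    by rewrite [_ * M]mulnC -(card_avoiding v) -sum_nat_const; apply: leq_sum.
  rewrite -big_distrr /= big_split /= mulnDr.
  have := sum_nbr_avoiding_ge v.
  rewrite mulnBl mul1n; move: (P) (N) (M) (\sum_(A in _) _) (\sum_(A in _) _) => p x y s1 s2.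
  lia.
pose trip (A B : {set T}) := [set x | [&& x \notin A, x \notin B & x != v]].
have trip_ge A B : A \in avoiding v -> B \in avoiding v -> n <= 2 * #|trip A B|.
  move=> inA inB; have : n - (k + q) <= #|trip A B|.
    rewrite -[trip A B]setCK [leqRHS]cardsCs setCK leq_sub2l //.
    apply: leq_trans (_ : #|A :|: (v |: B)| <= _).
      by apply: subset_leq_card; apply/subsetP => x; rewrite /trip !inE;
         case: (x \in A); case: (x \in B); case: (x == v).
    apply: leq_trans (leq_card_setU _ _) _; rewrite (cA _ inB) leq_add2r.
    by move: inA; rewrite !inE => /andP[/eqP->].
  by have [_ [+ _]] := n_lower_bounds; lia.
have trip_le A B : A \in avoiding v -> B \in avoiding v -> #|trip A B| <=
    #|[set x | (x \notin B) && (x |: B \in fault false (v |: A))]|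
    + #|[set x | (x \notin A) && (x |: A \in fault true (v |: B))]|.
  move=> inA inB; apply: leq_trans (leq_card_setU _ _).
  apply: subset_leq_card; apply/subsetP => x; rewrite in_setU !in_set.
  move=> /and3P[xA xB xv]; rewrite xA xB /=.
  move: inA inB; rewrite !in_set => /andP[/eqP cardA vA] /andP[/eqP cardB vB].
  rewrite !cardsU1 xA xB cardA cardB eqxx /=.
  have -> : adj H (v |: A) (x |: B) = adj H (v |: B) (x |: A).
    have UE : (v |: A) :|: (x |: B) = (v |: B) :|: (x |: A) by rewrite setUACA [A :|: B]setUC setUACA.
    rewrite /adj UE ![[disjoint _ :|: _ & _]]disjoint_setU ?disjoints1 !in_setU !in_set1.
    rewrite ![[disjoint _ & _ |: _]]disjoint_sym !disjoint_setU1 xA xB (negbTE vA) (negbTE vB) /=.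
    by rewrite [[disjoint B & A]]disjoint_sym.
  have -> : (par (x |: B) == par (v |: A)) = (par (x |: A) == par (v |: B)).
    rewrite /par !odd_card_setU1 //.
    by do 2!case: (_ \in U); do 2!case: odd.
  by case: (adj _ _ _ == _).
have fault_card b A : {in fault b A, forall E : {set T}, #|E| = q}.
  by move=> E; rewrite !in_set => /andP[/eqP].
have Ab_sub A : A \in Ab -> A \in avoiding v by rewrite inAb => /andP[].
have Ag_sub A : A \in Ag -> A \in avoiding v by rewrite inAg => /andP[].
have upper : \sum_(A in Ab) \sum_(B in Ag) #|trip A B| <= q * \sum_(A in avoiding v) cost A.
  apply: leq_trans (_ : \sum_(A in Ab) \sum_(B in Ag) (
    #|[set x | (x \notin B) && (x |: B \in fault false (v |: A))]|
    + #|[set x | (x \notin A) && (x |: A \in fault true (v |: B))]|) <= _).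
    by apply: leq_sum => A /Ab_sub inA; apply: leq_sum => B /Ag_sub inB; apply: trip_le.
  under eq_bigr => A _ do rewrite big_split /=.
  rewrite big_split /= [X in _ + X <= _]exchange_big /= big_split /= mulnDr.
  have drop (X : {set {set T}}) (F : {set T} -> nat) : (forall A, A \in X -> A \in avoiding v) ->
      \sum_(A in avoiding v) (if A \in X then F A else 0) = \sum_(A in X) F A.
    move=> sX; rewrite -big_mkcondr /=; apply: eq_bigl => A.
    by case AX: (A \in X); rewrite ?andbF // (sX _ AX).
  rewrite !drop // !big_distrr /=.
  by apply: leq_add; apply: leq_sum => A _; rewrite [leqRHS]mulnC; apply: sum_extensions_le.
have lower : #|Ab| * (#|Ag| * n) <= 2 * \sum_(A in Ab) \sum_(B in Ag) #|trip A B|.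
  rewrite -sum_nat_const big_distrr /=; apply: leq_sum => A /Ab_sub inA.
  rewrite -sum_nat_const big_distrr /=; apply: leq_sum => B /Ag_sub inB.
  exact: trip_ge.
have [_ [_ n0]] := n_lower_bounds.
have prod_le : P * (#|Ab| * #|Ag|) <= 6 * M ^ 2.
  rewrite -(leq_pmul2l n0).
  apply: leq_trans (_ : q * (6 * (M * N)) <= _); last first.
    by rewrite -mulnn; have := mul_card_star; nia.
  apply: leq_trans (_ : q * (2 * P * \sum_(A in avoiding v) cost A) <= _); last first.
    by rewrite leq_mul2l cost_sum orbT.
  have := leq_mul (leqnn P) (leq_trans lower (leq_mul (leqnn 2) upper)); lia.
have M0 : 0 < M by have := mul_card_star; case: (M) => // e; move: N0; rewrite muln0 in e; lia.
have := leq_mul manyb manyg; move: prod_le; rewrite -!mulnn => h1 h2.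
have : 0 < M * M by rewrite muln_gt0 M0.
lia.
Qed.

Lemma sum_missing_small v : L * \sum_(A in avoiding v) #|nbr missing q (v |: A)| <= 2 * (M * N).
Proof.
have L0 := L_gt0; have P0 : 0 < P by rewrite muln_gt0 expn_gt0 L0.
have le1 : 2 * P * \sum_(A in avoiding v) (#|nbr missing q (v |: A)| + #|nbr H q (v |: A)|)
    <= (P + 1) * (M * N) + 2 * P * \sum_(A in avoiding v) #|nbr bad q (v |: A)|.
  have -> : (P + 1) * (M * N) = \sum_(A in avoiding v) (P + 1) * N.
    by rewrite sum_nat_const card_avoiding mulnCA.
  rewrite !big_distrr -big_split /=; apply: leq_sum => A inA.
  have cA := card_setU1_avoiding inA; rewrite nbr_split addnCA mulnDr [leqRHS]addnC leq_add2l.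
  apply: leq_trans (parity_balanced (~~ par (v |: A))).
  by rewrite leq_mul2l; apply/orP; right; apply: nbr_good_le.
move: le1; rewrite big_split /= mulnDr.
have := sum_nbr_avoiding_ge v; rewrite mulnBl mul1n.
move: (sum_bad_small v).
have LP : L <= P by rewrite -mulnn mulnA leq_pmull // muln_gt0 L0.
move: P0 LP; move: (P) (M * N) => p mn p0 Lp.
move: (\sum_(A in _) _) (\sum_(A in _) _) (\sum_(A in _) _) => sm sh sb h1 h2 h3.
have {}h3 : 2 * p * sm <= 2 * mn + 2 * p * sb by lia.
have h4 := leq_mul (leqnn L) h3; have h5 := leq_mul (leqnn (2 * p)) h1.
have h6 := leq_mul Lp (leqnn mn).
rewrite -(leq_pmul2l p0); lia.
Qed.

Definition heavy : {set {set T}} := [set A in ksets T q | N <= 8 * #|nbr missing q A|].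

Lemma star_heavy_small v : L * #|star heavy v| <= 16 * M.
Proof.
rewrite -(leq_pmul2l N_gt0).
have le : N * #|star heavy v| <= 8 * \sum_(A in avoiding v) #|nbr missing q (v |: A)|.
  rewrite -card_link mulnC -sum_nat_const big_distrr /= big_mkcond [leqRHS]big_mkcond /=.
  apply: leq_sum => A _; rewrite !in_set; case: (boolP (v \in A)) => //= vA.
  by rewrite cardsU1 vA andbT eqSS; case: ifP => // /andP[-> ].
have := leq_mul (leqnn L) le; have := sum_missing_small v; lia.
Qed.

Lemma card_heavy_le : N * #|heavy| <= 8 * (#|bad| * K).
Proof.
apply: leq_trans (_ : 8 * (#|missing| * K) <= _).
  rewrite -(sum_nbr uniform_missing) mulnC -sum_nat_const big_distrr /= big_mkcond [leqRHS]big_mkcond /=.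
  by apply: leq_sum => A _; rewrite [A \in heavy]in_set; case: (A \in ksets _ _) => //=; case: ifP.
by rewrite leq_mul2l leq_mul2r missing_le_bad orbT.
Qed.

Lemma bad_half_heavy (E A : {set T}) : E \in bad -> A \subset E -> #|A| = q ->
  (A \in heavy) || (E :\: A \in heavy).
Proof.
move=> inE sAE cA; have cE := uniform_bad inE.
have cB : #|E :\: A| = q by rewrite cardsD (setIidPr sAE) cE cA addKn.
have EE := setU_setD sAE; have dAB := disjoint_setD A E.
move: inE; rewrite in_setD => /andP[nPF EH].
have Aq : A \in ksets T q by rewrite in_set cA.
have Bq : E :\: A \in ksets T q by rewrite in_set cB.
have pB : par (E :\: A) = par A.
  apply/eqP; move: nPF; rewrite in_parity_family cE eqxx /= {1}EE parity_setU //.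
  by rewrite /par; case: odd; case: odd.
have sub : parity_class (~~ par A) \subset
    (nbr missing q A :|: nbr missing q (E :\: A)) :|: [set C in ksets T q | ~~ [disjoint C & E]].
  apply/subsetP => C; rewrite in_parity_class => /andP[Cq /eqP pC].
  rewrite !in_setU !in_nbr [X in _ || X]in_set Cq /=.
  have cC : #|C| = q by move: Cq; rewrite in_set => /eqP.
  have [dCE|] := boolP [disjoint C & E]; last by rewrite orbT.
  rewrite orbF; have dAC : [disjoint A & C] by rewrite disjoint_sym; apply: disjointWr dCE.
  have dBC : [disjoint E :\: A & C] by rewrite disjoint_sym; apply: disjointWr dCE; apply: subsetDl.
  rewrite /adj dAC dBC /= !in_setD !in_parity_family !disjoint_card // cA cB cC eqxx !parity_setU //=.
  rewrite -/(par A) -/(par C) -/(par (E :\: A)) pB pC.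
  apply: contraT; rewrite negb_or !negb_and !negbK => /andP[h1 h2].
  have p1 : par A (+) ~~ par A by case: (par A).
  rewrite !p1 !orbF in h1 h2.
  by case: (Hfree Aq Bq Cq); rewrite /adj ?dAC ?dBC ?dAB -?EE.
have le1 := leq_trans (subset_leq_card sub) (leq_card_setU _ _).
have le2 := leq_trans le1 (leq_add (leq_of_leqif (leq_card_setU _ _)) (leqnn _)).
have := leq_trans le2 (leq_add (leqnn _) (card_meeting k E)); rewrite cE => le3.
rewrite !in_set cA cB eqxx /=; apply: contraT; rewrite negb_or -!ltnNge => /andP[lt1 lt2].
have bal := parity_balanced (par A); have tot := card_parity_class (par A).
have L0 := L_gt0; have P16 : 16 <= P by rewrite leq_pmulr // expn_gt0 L0.
have small : 16 * (q * M) <= N by apply: leq_trans qM_small; rewrite leq_pmull // (leq_trans _ P16).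
have bal2 : 16 * #|parity_class (par A)| <= 9 * N.
  have P0 : 0 < P by exact: leq_trans P16.
  rewrite -(leq_pmul2l P0); have := leq_mul P16 (leqnn N).
  by move: (P) (N) (#|parity_class _|) bal => p m x; clear; lia.
move: le3 lt1 lt2 small bal2 tot.
by move: (N) (#|nbr _ _ _|) (#|nbr _ _ _|) (#|parity_class _|) (#|parity_class _|); clear; lia.
Qed.

Lemma card_bad_le : #|bad| <= \sum_(A in heavy) \sum_(v in A) #|star heavy v| * n.
Proof.
pose R := \bigcup_(A in heavy) \bigcup_(v in A)
  [set A :|: p.1 :|: [set p.2] | p in setX (star heavy v) [set: T]].
apply: leq_trans (_ : #|R| <= _).
  apply: subset_leq_card; apply/subsetP => E inE.
  have cE := uniform_bad inE.
  have [A [B [Ah Bh sA sB cAB]]] := two_sets_meeting_once cE (fun A => @bad_half_heavy E A inE).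
  have cA : #|A| = q by move: Ah; rewrite !in_set => /andP[/eqP].
  have cB : #|B| = q by move: Bh; rewrite !in_set => /andP[/eqP].
  have /cards1P[v ABv] := introT eqP cAB.
  have : v \in A :&: B by rewrite ABv in_set1.
  rewrite in_setI => /andP[vA vB].
  have sU : A :|: B \subset E by rewrite subUset sA.
  have /cards1P[x Ex] : #|E :\: (A :|: B)| == 1.
    by rewrite cardsD (setIidPr sU) cardsU cAB cA cB cE; apply/eqP; clear; lia.
  apply/bigcupP; exists A => //; apply/bigcupP; exists v => //.
  apply/imsetP; exists (B, x); first by rewrite in_setX in_setT [_ \in star _ _]in_set Bh vB.
  by rewrite /= -Ex; apply: setU_setD.
apply: leq_trans (card_bigcup_le _ _) _; apply: leq_sum => A _.
apply: leq_trans (card_bigcup_le _ _) _; apply: leq_sum => v _.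
by apply: leq_trans (leq_imset_card _ _) _; rewrite cardsX cardsT.
Qed.

Lemma near_extremal_eq : H = PF U.
Proof.
have bad_small : L * #|bad| <= #|heavy| * (q * (16 * (q * N))).
  apply: leq_trans (leq_mul (leqnn L) card_bad_le) _.
  rewrite big_distrr -sum_nat_const /=; apply: leq_sum => A; rewrite in_set => /andP[].
  rewrite in_set => /eqP cA _.
  apply: leq_trans (_ : \sum_(v in A) 16 * (q * N) <= _); last by rewrite sum_nat_const cA.
  rewrite big_distrr /=; apply: leq_sum => v _.
  have := leq_mul (leqnn n) (star_heavy_small v); rewrite -mul_card_star.
  by move: (n) (M) (#|star _ _|); clear; lia.
have heavy0 : #|heavy| = 0.
  have le := card_heavy_le; have N0 := N_gt0; have K0 := K_gt0.
  have h1 : L * (N * #|heavy|) <= 128 * q ^ 2 * K * (N * #|heavy|).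
    have := leq_mul (leqnn L) le; have := leq_mul (leqnn (8 * K)) bad_small.
    by rewrite -mulnn; move: (N) (K) (#|heavy|) (#|bad|) => *; lia.
  case: (posnP #|heavy|) => // h0.
  by move: h1; rewrite leq_pmul2r ?muln_gt0 ?N0 // leqNgt L_large.
have bad0 : bad = set0.
  apply/eqP; rewrite -cards_eq0 -leqn0; apply: leq_trans card_bad_le _.
  by rewrite (eqP (_ : heavy == set0)) ?big_set0 // -cards_eq0 heavy0.
by apply/eqP; rewrite eqEcard -setD_eq0 -/bad bad0 eqxx Hopt.
Qed.
End NearExtremal.

(** * Vertex deletion *)

Definition large_L k := (128 * k.+1 ^ 2 * 'C(k.+1 + k.+1, k.+1)).+1.

Definition large_n k := (16 * large_L k ^ 2) ^ 2 *
  (2 * 'C(k.+1 + k.+1, k.+1) * stability_const k + 4 * k.+1 ^ 2) + (k.+1 + k.+1).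

Lemma min_degree_extremal (T : finType) (k : nat) (H : {set {set T}}) :
  large_n k <= #|T| ->
  {in H, forall E : {set T}, #|E| = k.+1 + k.+1} -> C3_free k.+1 H ->
  (forall v, 'C(#|T|.-1, k + k.+1) <= 2 * #|star H v|) ->
  (forall U : {set T}, #|parity_family (k.+1 + k.+1) U| <= #|H|) ->
  exists U, H = parity_family (k.+1 + k.+1) U.
Proof.
move=> n_large Hr Hfree Hdeg Hopt.
have Hlarge : 'C(#|T|, k.+1 + k.+1) <= 2 * #|H|.
  have := mul_bin_diag #|T| (k + k.+1); rewrite -addSn => eqC.
  rewrite -(@leq_pmul2l (k.+1 + k.+1)) // -eqC mulnC [leqRHS]mulnC -mulnA -(sum_star Hr).
  by rewrite big_distrr /= mulnC -sum_nat_const; apply: leq_sum => v _; apply: Hdeg.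
have len : k.+1 + k <= #|T|.
  by apply: leq_trans n_large; rewrite /large_n addnS -addSn; lia.
have [U0 U0_bad] := stability Hr Hfree Hlarge len.
pose score (U : {set T}) := #|H :&: parity_family (k.+1 + k.+1) U|.
have [U _ U_max] := arg_maxnP score (isT : (fun=> true) U0).
exists U; apply: (@near_extremal_eq T k H U (stability_const k) (large_L k)) => //.
- by move=> U'; apply: U_max.
- apply: leq_trans U0_bad; rewrite leq_mul2l; apply/orP; right.
  by rewrite !cardsD leq_sub2l //; apply: U_max.
by apply: leq_trans n_large; rewrite leq_addr.
Qed.

Section Deletion.
Variables (n : nat) (v : 'I_n.+1).
Implicit Types (H : {set {set 'I_n.+1}}).

Definition delete H : {set {set 'I_n}} := [set e : {set 'I_n} | lift v @: e \in H].

Lemma lift_preimK (E : {set 'I_n.+1}) : v \notin E -> lift v @: (lift v @^-1: E) = E.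
Proof.
move=> vE; apply/setP => x; apply/imsetP/idP => [[y + ->]|xE]; first by rewrite inE.
have nvx : v != x by apply: contraNneq vE => ->.
by have [y xy] := unlift_some nvx; exists y; rewrite // inE -xy.
Qed.

Lemma card_delete H : #|delete H| + #|star H v| = #|H|.
Proof.
have inj := imset_inj (@lift_inj _ v).
rewrite -(card_imset _ inj) addnC -(cardsID (star H v) H); congr (_ + _).
  by apply: eq_card => E; rewrite !inE andbA andbb.
apply: eq_card => E; rewrite !inE; apply/imsetP/andP => [[e + ->]|[+ EH]].
  rewrite inE => eH; split=> //; rewrite eH /=; apply/imsetP => -[x _ /eqP].
  by rewrite (negbTE (neq_lift _ _)).
by rewrite EH /= => vE; exists (lift v @^-1: E); rewrite ?inE lift_preimK.
Qed.

Lemma uniform_delete r H : {in H, forall E : {set 'I_n.+1}, #|E| = r} ->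
  {in delete H, forall E : {set 'I_n}, #|E| = r}.
Proof.
by move=> Hr E; rewrite inE => /Hr; rewrite card_imset //; exact: lift_inj.
Qed.

Lemma C3_free_delete q H : C3_free q H -> C3_free q (delete H).
Proof.
move=> Hfree P Q R; rewrite !inE => /eqP cP /eqP cQ /eqP cR.
have adjE A B : adj (delete H) A B -> adj H (lift v @: A) (lift v @: B).
  by rewrite /adj inE imsetU imset_disjoint //; exact: lift_inj.
move=> /adjE PQ /adjE PR /adjE QR; apply: Hfree PQ PR QR;
  by rewrite inE card_imset ?cP ?cQ ?cR //; exact: lift_inj.
Qed.

Lemma delete_parity_family m (W : {set 'I_n.+1}) :
  delete (parity_family m W) = parity_family m (lift v @^-1: W).
Proof.
apply/setP => e; rewrite !inE card_imset; last exact: lift_inj.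
congr (_ && odd _); rewrite -(card_imset (mem (e :&: _)) (@lift_inj _ v)).
apply: eq_card => x; rewrite inE; apply/andP/imsetP => [[/imsetP[y ye ->] yW]|[y]].
  by exists y; rewrite // !inE ye.
by rewrite !inE => /andP[ye yW] ->; split=> //; apply: imset_f.
Qed.

End Deletion.

Lemma exists_perm_imset (T : finType) (A B : {set T}) : #|A| = #|B| ->
  exists s : {perm T}, s @: A = B.
Proof.
move=> /esym cAB; move: B (subsetT B) cAB.
apply: (johnson_connected (P := fun B : {set T} => exists s : {perm T}, s @: A = B) (subsetT A)).
  by exists 1%g; rewrite -[RHS]imset_id; apply: eq_imset => x; rewrite perm1.
move=> B a b _ [s <-{B}] aB; set B := s @: A in aB *; rewrite !inE => /andP[bB _].
exists (s * tperm a b)%g; apply/setP => x; rewrite !inE.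
have -> : (x \in (s * tperm a b)%g @: A) = (tperm a b x \in B).
  apply/imsetP/imsetP => [[y yA ->]|[y yA e]]; exists y => //; first by rewrite permM tpermK.
  by rewrite permM -e tpermK.
case: tpermP => [->|->|/eqP xa /eqP xb].
- by rewrite (negbTE bB) eqxx /= orbF; apply/esym/negbTE; apply: contraNneq bB => <-.
- by rewrite aB eqxx.
by rewrite (negbTE xb) xa.
Qed.

Lemma parity_family_imset (T : finType) m (U : {set T}) (s : {perm T}) :
  parity_family m (s @: U) = [set [set s x | x in e] | e : {set T} in parity_family m U].
Proof.
have sK (E : {set T}) : s @: (s @^-1: E) = E.
  apply/setP => x; apply/imsetP/idP => [[y + ->]|xE]; first by rewrite inE.
  by exists (s^-1%g x); rewrite ?inE permKV.
have sI (e : {set T}) : #|s @: e :&: s @: U| = #|e :&: U|.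
  by rewrite -imsetI => [|x y _ _]; [rewrite card_imset //|]; exact: perm_inj.
have in_img (e : {set T}) : (s @: e \in parity_family m (s @: U)) = (e \in parity_family m U).
  by rewrite !inE sI card_imset //; apply: perm_inj.
apply/setP => E; apply/idP/imsetP => [|[e + ->]]; last by rewrite in_img.
by rewrite -{1}(sK E) in_img; exists (s @^-1: E); rewrite ?sK.
Qed.

Lemma Bhyp_parity n q a : Bhyp n q a = parity_family (q + q) (V1 n a).
Proof.
apply/setP => e; rewrite !inE mul2n -addnn; case: eqP => //= ce.
have := cardsID (V1 n a) e; rewrite -setDE ce addnn => /(congr1 odd).
by rewrite odd_double oddD; case: odd; case: odd.
Qed.

Lemma card_V1 n a : a <= n -> #|V1 n a| = a.
Proof.
move=> lean; have -> : V1 n a = [set widen_ord lean i | i in 'I_a].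
  apply/setP => i; rewrite inE; apply/idP/imsetP => [lti|[j _ ->]]; last exact: (ltn_ord j).
  by exists (Ordinal lti) => //; apply: val_inj.
by rewrite card_imset ?card_ord // => i j /(congr1 val) /= /val_inj.
Qed.

Lemma parity_family_iso n q (U : {set 'I_n}) :
  hiso (parity_family (q + q) U) (Bhyp n q #|U|).
Proof.
have [|s sU] := @exists_perm_imset _ (V1 n #|U|) U.
  by rewrite card_V1 // -[leqRHS]card_ord max_card.
by exists s; rewrite Bhyp_parity -parity_family_imset sU.
Qed.

Lemma hiso_card n (H G : {set {set 'I_n}}) : hiso H G -> #|H| = #|G|.
Proof.
by move=> [s ->]; rewrite card_imset //; apply: imset_inj; apply: perm_inj.
Qed.

Lemma card_parity_family_le n q (U : {set 'I_n}) : #|parity_family (q + q) U| <= bmax n q.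
Proof.
rewrite (hiso_card (parity_family_iso q U)).
have ltU : #|U| < n.+1 by rewrite ltnS -[leqRHS]card_ord max_card.
exact: (leq_bigmax (Ordinal ltU)).
Qed.

Lemma bmax_step n k : 2 * bmax n k.+1 + 'C(n, k + k.+1) <= 2 * bmax n.+1 k.+1.
Proof.
have [U ->] : exists U : {set 'I_n}, bmax n k.+1 = #|parity_family (k.+1 + k.+1) U|.
  rewrite /bmax; have [|a ->] := @eq_bigmax _ (fun a : 'I_n.+1 => #|Bhyp n k.+1 a|).
    by rewrite card_ord.
  by exists (V1 n a); rewrite Bhyp_parity.
pose W := lift ord0 @: U.
have card_W (W' : {set 'I_n.+1}) : lift ord0 @^-1: W' = U ->
    #|parity_family (k.+1 + k.+1) U| + #|star (parity_family (k.+1 + k.+1) W') ord0| <= bmax n.+1 k.+1.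
  move=> <-; rewrite -delete_parity_family card_delete; exact: card_parity_family_le.
have W0 : ord0 \notin W by apply/imsetP => -[x _ /eqP]; rewrite (negbTE (neq_lift _ _)).
have eq1 : lift ord0 @^-1: W = U.
  by apply/setP => x; rewrite inE mem_imset //; exact: lift_inj.
have eq2 : lift ord0 @^-1: (ord0 |: W) = U.
  by rewrite -[RHS]eq1; apply/setP => x; rewrite !inE eq_sym (negbTE (neq_lift _ _)).
have starC : 'C(n, k + k.+1) <= #|star (parity_family (k.+1 + k.+1) W) ord0|
    + #|star (parity_family (k.+1 + k.+1) (ord0 |: W)) ord0|.
  have -> : 'C(n, k + k.+1) = #|star (ksets 'I_n.+1 (k + k.+1).+1) ord0|.
    by rewrite card_star_ksets card_ord.
  apply: leq_trans (leq_card_setU _ _); apply: subset_leq_card; apply/subsetP => E.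
  rewrite !inE => /andP[-> E0]; rewrite E0 !andbT /= [_ :&: (_ |: _)]setIC odd_card_setU1 // E0.
  by rewrite [W :&: E]setIC orbN.
rewrite !mul2n -!addnn; apply: leq_trans (leq_add (leqnn _) starC) _.
by rewrite addnACA leq_add // card_W.
Qed.

Lemma extremal_or_delete n k (H : {set {set 'I_n.+1}}) : large_n k <= n.+1 ->
  {in H, forall E : {set 'I_n.+1}, #|E| = k.+1 + k.+1} -> C3_free k.+1 H ->
  bmax n.+1 k.+1 <= #|H| ->
  (exists U, H = parity_family (k.+1 + k.+1) U) \/
  exists H' : {set {set 'I_n}},
    [/\ {in H', forall E : {set 'I_n}, #|E| = k.+1 + k.+1}, C3_free k.+1 H'
      & bmax n k.+1 + #|H| < #|H'| + bmax n.+1 k.+1].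
Proof.
move=> ln Hr Hfree Hb.
case: (boolP [forall v, 'C(n, k + k.+1) <= 2 * #|star H v|]) => [/forallP Hdeg|].
  left; apply: min_degree_extremal => //; rewrite ?card_ord // => U.
  exact: leq_trans (card_parity_family_le _ _) Hb.
rewrite negb_forall => /existsP[v]; rewrite -ltnNge => ltv; right.
exists (delete v H); split; [exact: uniform_delete|exact: C3_free_delete|].
by have := card_delete v H; have := bmax_step n k; lia.
Qed.

Lemma card_le_bmax_add k i (H : {set {set 'I_(large_n k + i)}}) :
  {in H, forall E : {set 'I_(large_n k + i)}, #|E| = k.+1 + k.+1} -> C3_free k.+1 H ->
  #|H| <= bmax (large_n k + i) k.+1 + ('C(large_n k, k.+1 + k.+1) - i).
Proof.
elim: i H => [|i IHi] H Hr Hfree.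
  rewrite subn0; apply: leq_trans (leq_addl _ _).
  have := card_ksets 'I_(large_n k + 0) (k.+1 + k.+1); rewrite card_ord [X in 'C(X, _)]addn0 => <-.
  by apply: subset_leq_card; apply/subsetP => E /Hr cE; rewrite inE cE.
move: H Hr Hfree; rewrite addnS => H Hr Hfree; rewrite leqNgt; apply/negP => ltH.
have Hb := leq_trans (leq_addr _ _) (ltnW ltH).
have [|[U HU]|[H' [Hr' Hfree' lt]]] := extremal_or_delete _ Hr Hfree Hb.
- by rewrite -addnS leq_addr.
- by have := card_parity_family_le k.+1 U; rewrite -HU; lia.
by have := IHi H' Hr' Hfree'; lia.
Qed.

Lemma C3_freeP n q (H : {set {set 'I_n}}) : ~ has_C3 q H -> C3_free q H.
Proof.
move=> noC3 P Q R; rewrite !inE => /eqP cP /eqP cQ /eqP cR.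
move=> /andP[dPQ PQ] /andP[dPR PR] /andP[dQR QR]; apply: noC3.
by exists P, Q, R.
Qed.

Theorem theorem1 (k : nat) (hk : 1 <= k) :
  exists n0 : nat, forall n : nat, n0 <= n ->
    forall H : {set {set 'I_n}},
      uniform (2 * k) H -> ~ has_C3 k H ->
      #|H| <= bmax n k /\
      (#|H| = bmax n k ->
         exists a : nat, a <= n /\ #|Bhyp n k a| = bmax n k /\ hiso H (Bhyp n k a)).
Proof.
case: k hk => // k _; pose m := large_n k + 'C(large_n k, k.+1 + k.+1).
have upper n (H : {set {set 'I_n}}) : m <= n ->
    {in H, forall E : {set 'I_n}, #|E| = k.+1 + k.+1} -> C3_free k.+1 H -> #|H| <= bmax n k.+1.
  move=> len; have nE : n = large_n k + (n - large_n k) by rewrite subnKC //; lia.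
  move: H; rewrite nE => H Hr Hfree; apply: leq_trans (card_le_bmax_add Hr Hfree) _.
  lia.
exists m.+1 => -[//|n] len H; rewrite mul2n -addnn => Hr /C3_freeP Hfree.
split=> [|eqH]; first exact: upper (ltnW len) Hr Hfree.
have [||[U HU]|[H' [Hr' Hfree' lt]]] := extremal_or_delete _ Hr Hfree.
- by apply: leq_trans (ltnW len); rewrite leq_addr.
- by rewrite eqH.
- exists #|U|; rewrite -[X in _ <= X]card_ord max_card HU -(hiso_card (parity_family_iso _ U)) -HU.
  by split=> //; split=> //; rewrite HU; apply: parity_family_iso.
by have := upper n H' len Hr' Hfree'; move: lt; rewrite eqH; lia.
Qed.
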